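(* Let $X$ and $Y$ be proper geodesic hyperbolic spaces. If $f\colon X\to Y$ is radial, then $f$ induces a H\''older map $$\tilde f\colon\partial X\to\partial Y$$ between the boundaries when these are equipped with visual metrics.
   Context: For a metric space $(X,d)$ and $a,x,y\in X$ the Gromov product is $(x,y)_a=\frac12\big(d(x,a)+d(y,a)-d(x,y)\big)$. $X$ is hyperbolic if for some $\delta$ it satisfies $(x,y)_{x_0}\ge \min\{(x,z)_{x_0},(z,y)_{x_0}\}-\delta/4$ for all $x,y,z,x_0\in X$. Proper means that closed balls are compact. The boundary $\partial X$ of a proper hyperbolic geodesic space $X$ with basepoint $a$ is the set of sequences $(x_n)$ in $X$ with $\liminf_{i,j\to\infty}(x_i,x_j)_a=\infty$, modulo $(x_n)\sim(y_n)$ iff $\liminf_{i,j\to\infty}(x_i,y_j)_a=\infty$. For $p,q\in\partial X$ put $(p,q)_a=\inf\liminf_{i\to\infty}(x_i,y_i)_a$, the infimum over all sequences with $p=[(x_i)]$, $q=[(y_i)]$. A metric $d$ on $\partial X$ is visual if there are constants $K,C>1$ with $\frac{K^{-(p,q)_a}}{C}\le d(p,q)\le C\,K^{-(p,q)_a}$ for all $p,q\in\partial X$. Visual metrics exist and are all H\''older-equivalent. A map $g$ between metric spaces is H\''older if there are $A,B>0$ with $d(g(p),g(q))\le B\,d(p,q)^A$ for all $p,q$. $f\colon X\to Y$ is large scale Lipschitz if there are $\lambda_1,\mu_1>0$ with $d(f(x),f(y))\le\lambda_1 d(x,y)+\mu_1$ for all $x,y$. It is radial (with respect to $x_0\in X$)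 if it is large scale Lipschitz and there are $\lambda_2,\mu_2>0$ such that for every finite geodesic $\gamma\colon[0,M]\to X$ with $\gamma(0)=x_0$, $\lambda_2 d(x,y)-\mu_2\le d(f(x),f(y))$ for all $x,y$ in the image of $\gamma$; ''radial'' means radial with respect to some point of $X$. The induced map is $\tilde f([(x_n)])=[(f(x_n))]$ (the claim includes that this is well defined). *)

(* Defs.v *)
From HB Require Import structures.
From mathcomp Require Import all_boot all_order all_algebra.
From mathcomp Require Import all_classical all_reals all_analysis.

Set Implicit Arguments.
Unset Strict Implicit.
Unset Printing Implicit Defensive.

Import Order.TTheory GRing.Theory Num.Theory.
Import numFieldNormedType.Exports.

Local Open Scope classical_set_scope.
Local Open Scope ring_scope.

Section Spaces.
Context {R : realType}.

Definition gromov {X : metricType R} (a x y : X) : R :=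
  (mdist x a + mdist y a - mdist x y) / 2.

Definition hyperbolic_space (X : metricType R) : Prop :=
  exists delta : R, forall x y z x0 : X,
    Num.min (gromov x0 x z) (gromov x0 z y) - delta / 4 <= gromov x0 x y.

(* [closed_ball] of the library is the closure of the open ball, which can be
   smaller than the set below. *)
Definition proper_space (X : metricType R) : Prop :=
  forall (x : X) (r : R), compact [set y | mdist x y <= r].

(* A geodesic [0, M] -> X is an isometric embedding; it is represented by a
   function on R of which only the values on [0, M] matter. *)
Definition geodesic {X : metricType R} (M : R) (gamma : R -> X) : Prop :=
  0 <= M /\
  forall s t, s \in `[0, M] -> t \in `[0, M] ->
    mdist (gamma s) (gamma t) = `|s - t|.

Definition geodesic_space (X : metricType R) : Prop :=
  forall x y : X, exists (M : R) (gamma : R -> X),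
    [/\ geodesic M gamma, gamma 0 = x & gamma M = y].

Definition large_scale_lipschitz {X Y : metricType R} (f : X -> Y) : Prop :=
  exists lambda mu : R, [/\ 0 < lambda, 0 < mu &
    forall x y, mdist (f x) (f y) <= lambda * mdist x y + mu].

Definition radial_at {X Y : metricType R} (x0 : X) (f : X -> Y) : Prop :=
  large_scale_lipschitz f /\
  exists lambda mu : R, [/\ 0 < lambda, 0 < mu &
    forall (M : R) (gamma : R -> X), geodesic M gamma -> gamma 0 = x0 ->
    forall x y, (gamma @` `[0, M]) x -> (gamma @` `[0, M]) y ->
      lambda * mdist x y - mu <= mdist (f x) (f y)].

Definition radial {X Y : metricType R} (f : X -> Y) : Prop :=
  exists x0 : X, radial_at x0 f.

Section Boundary.
Context {X : metricType R} (a : X).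

Definition liminf2_gromov (x y : nat -> X) : \bar R :=
  limf_einf (fun ij : nat * nat => (gromov a (x ij.1) (y ij.2))%:E)
    (filter_prod \oo \oo).

Definition to_infinity (x : nat -> X) : Prop := liminf2_gromov x x = +oo%E.

Definition bclass (x : nat -> X) : set (nat -> X) :=
  [set y | to_infinity y /\ liminf2_gromov x y = +oo%E].

(* Points of the boundary are the equivalence classes themselves, as sets of
   sequences. That the relation is an equivalence uses hyperbolicity, which is
   not needed to form the type. *)
Record boundary := Boundary {
  bseqs :> set (nat -> X);
  bseqs_class : exists2 x, to_infinity x & bseqs = bclass x }.

Definition bgromov (p q : boundary) : \bar R :=
  ereal_inf [set limn_einf (fun i => (gromov a (x i) (y i))%:E)
            | x in bseqs p & y in bseqs q].

End Boundary.

(* K ^ t for K > 0 and extended real t; for K > 1, K ^ -oo = 0. *)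
Definition powRe (K : R) (t : \bar R) : \bar R := expeR (t * (ln K)%:E)%E.

Definition is_metric (T : Type) (d : T -> T -> R) : Prop :=
  [/\ forall p q, 0 <= d p q,
      forall p q, d p q = 0 <-> p = q,
      forall p q, d p q = d q p &
      forall p q r, d p r <= d p q + d q r].

Definition visual {X : metricType R} (a : X)
    (d : boundary a -> boundary a -> R) : Prop :=
  is_metric d /\
  exists K C : R, [/\ 1 < K, 1 < C & forall p q : boundary a,
    (powRe K (- bgromov p q) * (C^-1)%:E <= (d p q)%:E /\
     (d p q)%:E <= C%:E * powRe K (- bgromov p q))%E].

Definition hoelder_map (S T : Type) (dS : S -> S -> R) (dT : T -> T -> R)
    (g : S -> T) : Prop :=
  exists A B : R, [/\ 0 < A, 0 < B &
    forall p q, dT (g p) (g q) <= B * dS p q `^ A].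

(* [F] is the map [(x_n)] |-> [(f (x_n))]; as the equation is required of every
   representative x of p, it contains the well-definedness of that map. *)
Definition induced_map {X Y : metricType R} (a : X) (b : Y) (f : X -> Y)
    (F : boundary a -> boundary b) : Prop :=
  forall (p : boundary a) (x : nat -> X), bseqs p x ->
    to_infinity b (f \o x) /\ bseqs (F p) = bclass b (f \o x).

End Spaces.

(* Main.v *)
Require Import Defs.
From mathcomp Require Import all_boot all_order all_algebra.
From mathcomp Require Import all_classical all_reals all_analysis.
From mathcomp Require Import lra ring.

(** The heart of the matter is the linear lower bound
    [A * (x, y)_a - B <= (f x, f y)_b] for all [x], [y] in [X]; it passes to
    sequences and their classes, and, exponentiated, becomes the Hoelder
    inequality.  To prove it, let [t = (x, y)_x0] and let [x'], [y'] be the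
    points at distance [t] from [x0] on geodesics to [x] and [y]; by
    hyperbolicity they are within a bounded distance of each other.  The Gromov
    product of [f x'] and [f y'] at [f x0] is then at least [lambda t - const],
    since these points are far from [f x0] and close to each other, and it
    remains to bound those of [f x'], [f x] and of [f y'], [f y] in the same
    way.  This needs no stability of quasi-geodesics: along the image of a
    geodesic the Gromov products of consecutive points of a sufficiently sparse
    sequence grow fast enough to be chained with a bounded loss. *)

Set Implicit Arguments.
Unset Strict Implicit.
Unset Printing Implicit Defensive.

Import Order.TTheory GRing.Theory Num.Theory.

Local Open Scope classical_set_scope.
Local Open Scope ring_scope.

Section LimitInferior.
Context {R : realType}.

Lemma lt_limf_einf (T : choiceType) (X : filteredType T) (F : set_system X)
    (g : X -> \bar R) (m : \bar R) : Filter F ->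
  (m < limf_einf g F)%E -> \forall x \near F, (m < g x)%E.
Proof.
move=> FF; rewrite limf_einfE => /ereal_sup_gt[_ [V FV <-]] mV.
apply: filterS FV => x Vx; apply: (lt_le_trans mV).
by apply: ereal_inf_lbound; exists x.
Qed.

Lemma limf_einf_ge (T : choiceType) (X : filteredType T) (F : set_system X)
    (g : X -> \bar R) (m : \bar R) :
  (\forall x \near F, (m <= g x)%E) -> (m <= limf_einf g F)%E.
Proof.
move=> Fm; rewrite limf_einfE; apply: le_ereal_sup_tmp.
exists (ereal_inf (g @` [set x | (m <= g x)%E])).
  by exists [set x | (m <= g x)%E].
by apply/ereal_infP => _ [x mx <-].
Qed.

Lemma limn_einfE (u : nat -> \bar R) : limn_einf u = limf_einf u \oo.
Proof. by []. Qed.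

Lemma liminf2_gromovP (X : metricType R) (a : X) (x y : nat -> X) :
  liminf2_gromov a x y = +oo%E <->
  forall m : R, exists N : nat, forall i j,
    (N <= i)%N -> (N <= j)%N -> m <= gromov a (x i) (y j).
Proof.
split=> [xy m|xy].
  have : (m%:E < liminf2_gromov a x y)%E by rewrite xy ltry.
  move=> /lt_limf_einf[[P Q] /= [[N _ PN] [N' _ QN]] PQ].
  exists (maxn N N') => i j; rewrite !geq_max => /andP[Ni _] /andP[_ Nj].
  have := PQ (i, j); rewrite /= lte_fin => /(_ _)/ltW; apply; split.
  - exact: PN.
  - exact: QN.
apply/eqyP => m m0; apply: limf_einf_ge.
have [N Nm] := xy m.
exists ([set i | (N <= i)%N], [set i | (N <= i)%N]); last first.
  by move=> [i j] /= [Ni Nj]; rewrite lee_fin Nm.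
by split; exists N.
Qed.

End LimitInferior.

Section Gromov.
Context {R : realType} {X : metricType R}.
Implicit Types (a o x y z : X).

Lemma gromovC a x y : gromov a x y = gromov a y x.
Proof. by rewrite /gromov (metric_sym x y) [mdist x a + _]addrC. Qed.

Lemma gromov_ge_dist o x y : mdist x o - mdist x y <= gromov o x y.
Proof. by rewrite /gromov; have := metric_triangle x y o; lra. Qed.

Lemma gromov_ge0 o x y : 0 <= gromov o x y.
Proof.
rewrite /gromov; have := metric_triangle x o y.
by rewrite (metric_sym o y); lra.
Qed.

Lemma gromov_le_dist o x y : gromov o x y <= mdist x o.
Proof.
rewrite /gromov; have := metric_triangle y x o.
by rewrite (metric_sym y x); lra.
Qed.

Lemma gromov_basepoint a o x y : gromov a x y <= gromov o x y + mdist o a.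
Proof.
rewrite /gromov; have := metric_triangle x o a; have := metric_triangle y o a.
lra.
Qed.

Definition hyperbolic_with (e : R) :=
  forall m o x y z, m <= gromov o x z -> m <= gromov o z y ->
    m - e <= gromov o x y.

Lemma hyperbolic_withP : hyperbolic_space X ->
  exists2 e, 0 < e & hyperbolic_with e.
Proof.
move=> [delta hyp]; exists (`|delta| / 4 + 1).
  by have := normr_ge0 delta; lra.
move=> m o x y z xz zy; apply: le_trans (hyp x y z o).
have : m <= Num.min (gromov o x z) (gromov o z y) by rewrite le_min xz.
have := ler_norm delta; lra.
Qed.

Lemma hyperbolic_with4 e m o x y x' y' : 0 < e -> hyperbolic_with e ->
  m <= gromov o x x' -> m <= gromov o x' y' -> m <= gromov o y' y ->
  m - e - e <= gromov o x y.
Proof.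
move=> e0 hyp xx' x'y' y'y; apply: (hyp _ _ _ _ x'); first by lra.
exact: (hyp _ _ _ _ y').
Qed.

Lemma geodesic_dist (M : R) (gamma : R -> X) s t : geodesic M gamma ->
  0 <= s -> s <= M -> 0 <= t -> t <= M -> mdist (gamma s) (gamma t) = `|s - t|.
Proof.
by move=> [_ geo] *; apply: geo; rewrite in_itv/=; apply/andP; split.
Qed.

(* Consecutive points at parameter distance [h = e / lambda] have Gromov product
   at least [lambda * s - (C - e)], a bound which grows by [e] at each step: this pays
   for the loss of [e] in each use of hyperbolicity, so that chaining costs [e]
   once and not at every step. *)
Lemma gromov_along_path (e M lambda mu L K : R) (o : X) (c : R -> X) :
  0 < e -> hyperbolic_with e -> 0 < lambda -> 0 < L ->
  (forall t, 0 <= t -> t <= M -> lambda * t - mu <= mdist (c t) o) ->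
  (forall s t, 0 <= s -> s <= t -> t <= M ->
    mdist (c s) (c t) <= L * (t - s) + K) ->
  forall s t, 0 <= s -> s <= t -> t <= M ->
    lambda * s - (mu + L * (e / lambda) + K + e) <= gromov o (c s) (c t).
Proof.
move=> e0 hyp l0 L0 far lip s t s0 st tM.
set h := e / lambda; set C := mu + L * h + K + e.
have h0 : 0 < h by rewrite divr_gt0.
have lh : lambda * h = e by rewrite mulrC divfK ?gt_eqF.
have near_ge r u : 0 <= r -> r <= u -> u <= M -> u - r <= h ->
    lambda * r - (C - e) <= gromov o (c r) (c u).
  move=> r0 ru uM urh; apply: le_trans (gromov_ge_dist _ _ _).
  have := far r r0 (le_trans ru uM); have := lip r u r0 ru uM.
  have : L * (u - r) <= L * h by rewrite ler_pM2l.
  by rewrite /C; lra.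
have chain (n : nat) : forall r, 0 <= r -> r <= t -> t - r <= n%:R * h ->
    lambda * r - C <= gromov o (c r) (c t).
  elim: n => [|n IH] r r0 rt.
    by rewrite mul0r => ?; have := near_ge r t r0 rt tM; lra.
  rewrite -natr1 mulrDl mul1r => trn.
  have [trh|trh] := leP (t - r) h.
    by have := near_ge r t r0 rt tM trh; lra.
  have -> : lambda * r - C = lambda * r - (C - e) - e by ring.
  apply: (hyp _ _ _ _ (c (r + h))); first by apply: near_ge; lra.
  apply: le_trans (IH (r + h) _ _ _); [rewrite mulrDr lh|..]; lra.
have ts0 : 0 <= (t - s) / h by rewrite divr_ge0 ?subr_ge0// ltW.
apply: (chain (Num.bound ((t - s) / h))) => //.
by rewrite -ler_pdivrMr// ltW// archi_boundP.
Qed.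

End Gromov.

Section RadialGromov.
Context {R : realType} {X Y : metricType R}.

Lemma radial_along_geodesic (f : X -> Y) (x0 : X) :
  geodesic_space X -> hyperbolic_space Y -> radial_at x0 f ->
  exists A B : R, 0 < A /\ forall x t, 0 <= t -> t <= mdist x x0 ->
    exists x', [/\ mdist x' x0 = t, gromov x0 x' x = t,
      A * t - B <= mdist (f x') (f x0) &
      A * t - B <= gromov (f x0) (f x') (f x)].
Proof.
move=> geodX /hyperbolic_withP[e e0 hyp] [[L [K [L0 K0 lip]]]].
move=> [lambda [mu [l0 m0 rad]]].
exists lambda, (mu + L * (e / lambda) + K + e); split=> // x t t0 tx.
have [M [gamma [geo gamma0 gammaM]]] := geodX x0 x.
have M0 : 0 <= M by case: geo.
have distM : mdist x x0 = M.
  rewrite -gamma0 -gammaM (geodesic_dist geo)//.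
  by rewrite subr0 ger0_norm.
rewrite distM in tx.
have dist0 s : 0 <= s -> s <= M -> mdist (gamma s) x0 = s.
  by move=> s0 sM; rewrite -gamma0 (geodesic_dist geo)// subr0 ger0_norm.
have far s : 0 <= s -> s <= M -> lambda * s - mu <= mdist (f (gamma s)) (f x0).
  move=> s0 sM; rewrite -[X in lambda * X](dist0 s)//.
  apply: (rad M gamma geo gamma0).
    by exists s => //=; rewrite in_itv/= s0.
  by exists 0 => //; rewrite /= in_itv/= lexx.
exists (gamma t); split.
- exact: dist0.
- rewrite /gromov distM dist0// -gammaM (geodesic_dist geo)// distrC ger0_norm; lra.
- have := far t t0 tx.
  have : 0 < L * (e / lambda) by rewrite mulr_gt0 ?divr_gt0.
  lra.
- rewrite -gammaM; apply: (gromov_along_path (M := M) (c := f \o gamma) e0 hyp l0 L0)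
    => //= s r s0 sr rM.
  apply: le_trans (lip _ _) _.
  rewrite (geodesic_dist geo)//; [|lra..].
  by rewrite distrC ger0_norm ?subr_ge0.
Qed.

Lemma radial_gromov_ge (f : X -> Y) (a : X) (b : Y) :
  geodesic_space X -> hyperbolic_space X -> hyperbolic_space Y -> radial f ->
  exists A B : R, 0 < A /\
    forall x y, A * gromov a x y - B <= gromov b (f x) (f y).
Proof.
move=> geodX /hyperbolic_withP[e e0 hypX] hypY [x0 rad].
have [A [B [A0 AB]]] := radial_along_geodesic geodX hypY rad.
have [eY eY0 {}hypY] := hyperbolic_withP hypY.
have [[L [K [L0 K0 lip]]] _] := rad.
exists A, (B + L * (4 * e) + K + eY + eY + A * mdist x0 a + mdist b (f x0)).
split=> // x y; set t := gromov x0 x y.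
have t0 : 0 <= t := gromov_ge0 _ _ _.
have [x' [x't x'x fx' fxx']] := AB x t t0 (gromov_le_dist _ _ _).
have ty : t <= mdist y x0 by rewrite /t gromovC gromov_le_dist.
have [y' [y't y'y fy' fyy']] := AB y t t0 ty.
have x'y' : mdist x' y' <= 4 * e.
  have := @hyperbolic_with4 _ _ e t x0 x' y' x y e0 hypX.
  rewrite x'x lexx (gromovC x0 y y') y'y lexx => /(_ isT isT isT).
  rewrite /gromov x't y't; lra.
have fx'y' : mdist (f x') (f y') <= L * (4 * e) + K.
  by apply: le_trans (lip _ _) _; rewrite lerD2r ler_pM2l.
have Le0 : 0 < L * (4 * e) by rewrite !mulr_gt0.
have : A * t - (B + L * (4 * e) + K) - eY - eY <= gromov (f x0) (f x) (f y).
  apply: (hyperbolic_with4 (x' := f x') (y' := f y')) => //.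
  - by rewrite gromovC; lra.
  - by have := gromov_ge_dist (f x0) (f x') (f y'); lra.
  - lra.
have := gromov_basepoint (f x0) b (f x) (f y).
have : A * gromov a x y <= A * (t + mdist x0 a).
  by rewrite ler_pM2l// gromov_basepoint.
rewrite mulrDr; lra.
Qed.

End RadialGromov.

Section BoundaryClasses.
Context {R : realType} {X : metricType R} (a : X).
Hypothesis hypX : hyperbolic_space X.
Implicit Types x y z : nat -> X.

Lemma liminf2_gromovC x y :
  liminf2_gromov a x y = +oo%E -> liminf2_gromov a y x = +oo%E.
Proof.
move=> /liminf2_gromovP xy; apply/liminf2_gromovP => m.
by have [N xyN] := xy m; exists N => i j Ni Nj; rewrite gromovC xyN.
Qed.

Lemma liminf2_gromov_trans x y z :
  liminf2_gromov a x y = +oo%E -> liminf2_gromov a y z = +oo%E ->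
  liminf2_gromov a x z = +oo%E.
Proof.
have [e e0 hyp] := hyperbolic_withP hypX.
move=> /liminf2_gromovP xy /liminf2_gromovP yz; apply/liminf2_gromovP => m.
have [[N xyN] [N' yzN']] := (xy (m + e), yz (m + e)).
exists (maxn N N') => i j; rewrite !geq_max => /andP[Ni _] /andP[_ N'j].
rewrite -[m](addrK e); apply: (hyp _ _ _ _ (y (maxn N N'))).
- by rewrite xyN// leq_maxl.
- by rewrite yzN'// leq_maxr.
Qed.

Lemma bclass_eq x y : liminf2_gromov a x y = +oo%E -> bclass a x = bclass a y.
Proof.
move=> xy; have yx := liminf2_gromovC xy.
by apply/seteqP; split=> z [zoo] /=; split=> //; apply: liminf2_gromov_trans; eauto.
Qed.

Lemma bseqs_to_infinity (p : boundary a) x : bseqs p x -> to_infinity a x.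
Proof. by case: p => P [y yoo /= ->] []. Qed.

Lemma bseqs_bclass (p : boundary a) x : bseqs p x -> bseqs p = bclass a x.
Proof. by case: p => P [y yoo /= ->] [_ yx]; exact: bclass_eq. Qed.

Lemma boundary_nonempty (p : boundary a) : exists x, bseqs p x.
Proof. by case: p => P [y yoo /= ->]; exists y. Qed.

End BoundaryClasses.

Section InducedMap.
Context {R : realType} {X Y : metricType R} (a : X) (b : Y) (f : X -> Y).
Context (A B : R).
Hypothesis hypX : hyperbolic_space X.
Hypothesis hypY : hyperbolic_space Y.
Hypothesis A0 : 0 < A.
Hypothesis fAB : forall x y, A * gromov a x y - B <= gromov b (f x) (f y).

Lemma liminf2_gromov_comp (x y : nat -> X) : liminf2_gromov a x y = +oo%E ->
  liminf2_gromov b (f \o x) (f \o y) = +oo%E.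
Proof.
move=> /liminf2_gromovP xy; apply/liminf2_gromovP => m.
have [N xyN] := xy ((m + B) / A); exists N => i j Ni Nj /=.
apply: le_trans (fAB _ _); rewrite lerBrDr mulrC -ler_pdivrMr//.
exact: xyN.
Qed.

Lemma induced_map_exists : exists F : boundary a -> boundary b, induced_map f F.
Proof.
have [rep repP] := choice (@boundary_nonempty _ _ a).
have foo (p : boundary a) x : bseqs p x -> to_infinity b (f \o x).
  by move=> /bseqs_to_infinity xoo; exact: (liminf2_gromov_comp xoo).
exists (fun p => Boundary (ex_intro2 _ _ _ (foo p _ (repP p)) erefl)).
move=> p x px; split=> /=; first exact: foo px.
apply: bclass_eq => //; apply: liminf2_gromov_comp.
by move: px; rewrite (bseqs_bclass hypX (repP p)) => -[_].
Qed.

Lemma induced_map_bgromov_ge (F : boundary a -> boundary b) :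
  induced_map f F -> exists B', forall (p q : boundary a) (m : R),
    (m%:E < bgromov p q)%E -> ((A * m - B')%:E <= bgromov (F p) (F q))%E.
Proof.
move=> fF; have [e e0 hyp] := hyperbolic_withP hypY.
exists (B + e + e) => p q m mpq.
have [[x px] [y qy]] := (boundary_nonempty p, boundary_nonempty q).
apply/ereal_infP => _ [u + [v + <-]].
rewrite (fF _ _ px).2 (fF _ _ qy).2 => -[_ xu] [_ yv].
have mxy : (m%:E < limf_einf (fun i => (gromov a (x i) (y i))%:E) \oo)%E.
  by apply: (lt_le_trans mpq); apply: ereal_inf_lbound; exists x => //; exists y.
have /liminf2_gromovP/(_ (A * m - B))[N xuN] := xu.
have /liminf2_gromovP/(_ (A * m - B))[N' yvN'] := yv.
rewrite limn_einfE; apply: limf_einf_ge; near=> i.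
have mi : m < gromov a (x i) (y i).
  by rewrite -lte_fin; near: i; apply: lt_limf_einf mxy.
have Ni : (N <= i)%N by near: i; exists N.
have N'i : (N' <= i)%N by near: i; exists N'.
have -> : A * m - (B + e + e) = A * m - B - e - e by ring.
rewrite lee_fin; apply: (hyperbolic_with4 (x' := f (x i)) (y' := f (y i))) => //.
- by rewrite gromovC; exact: xuN.
- by apply: le_trans (fAB _ _); rewrite lerD2r ler_pM2l// ltW.
- exact: yvN'.
Unshelve. all: by end_near. Qed.

End InducedMap.

Section Visual.
Context {R : realType}.

Lemma visual_fin_num_or_eq (X : metricType R) (a : X)
    (d : boundary a -> boundary a -> R) : visual d ->
  forall p q : boundary a, p = q \/ bgromov p q \is a fin_num.
Proof.
move=> [[d0 d_eq0 _ _] [K [C [K1 C1 dKC]]]] p q.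
have lnK : 0 < ln K by rewrite ln_gt0.
have C0 : 0 < C by lra.
have [] := dKC p q; rewrite /powRe; case: (bgromov p q) => [r|_|].
- by move=> _ _; right.
- rewrite /= mulNyr gtr0_sg// mul1e /= mule0 lee_fin => dpq.
  by left; apply/d_eq0/le_anti; rewrite dpq d0.
- by rewrite /= mulyr gtr0_sg// mul1e /= mulyr gtr0_sg ?invr_gt0// mul1e leye_eq.
Qed.

Lemma hoelder_of_bgromov_ge (X Y : metricType R) (a : X) (b : Y)
    (F : boundary a -> boundary b) (A B : R)
    (dX : boundary a -> boundary a -> R) (dY : boundary b -> boundary b -> R) :
  0 < A ->
  (forall (p q : boundary a) (m : R), (m%:E < bgromov p q)%E ->
    ((A * m - B)%:E <= bgromov (F p) (F q))%E) ->
  visual dX -> visual dY -> hoelder_map dX dY F.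
Proof.
move=> A0 FAB visX visY.
have [[dX0 dX_eq0 _ _] [K [C [K1 C1 dXKC]]]] := visX.
have [[_ dY_eq0 _ _] [K' [C' [K'1 C'1 dYKC]]]] := visY.
have lnK : 0 < ln K by rewrite ln_gt0.
have lnK' : 0 < ln K' by rewrite ln_gt0.
have C0 : 0 < C by lra.
have C'0 : 0 < C' by lra.
set E := A * ln K' / ln K.
have E0 : 0 < E by rewrite divr_gt0// mulr_gt0.
exists E, (C' * expR ((A + B) * ln K') * C `^ E); split=> //.
  by rewrite !mulr_gt0 ?expR_gt0 ?powR_gt0.
move=> p q; have [->|] := visual_fin_num_or_eq visX p q.
  rewrite (_ : dY _ _ = 0); last exact/dY_eq0.
  by rewrite !mulr_ge0 ?expR_ge0 ?powR_ge0// ltW.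
have := FAB p q; have [+ _] := dXKC p q.
rewrite /powRe; case: (bgromov p q) => // r dXr /(_ (r - 1)) Fpq _.
have {}Fpq := Fpq _.
have dYr : dY (F p) (F q) <= C' * expR (- (A * (r - 1) - B) * ln K').
  rewrite -lee_fin; apply: le_trans (dYKC _ _).2 _; rewrite EFinM lee_pmul2l//.
  rewrite (_ : (expR _)%:E = expeR ((- (A * (r - 1) - B) * ln K')%:E))//.
  rewrite lee_expeR EFinM lee_pmul2r// EFinN leeN2.
  by apply: Fpq; rewrite lte_fin; lra.
have {}dXr : expR (- r * ln K) <= C * dX p q.
  by move: dXr; rewrite -EFinN -EFinM lee_fin ler_pdivrMr// [C * _]mulrC.
have : expR (- r * ln K) `^ E <= (C * dX p q) `^ E.
  apply: ge0_ler_powR => //;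
    by rewrite ?(ltW E0) ?nnegrE ?expR_ge0 ?mulr_ge0 ?(ltW C0) ?dX0.
rewrite powRM ?(ltW C0)// -expRM => dXE.
apply: (le_trans dYr); rewrite -!mulrA ler_pM2l//.
have -> : - (A * (r - 1) - B) * ln K' = (A + B) * ln K' + - r * ln K * E.
  by rewrite /E; field; rewrite gt_eqF.
by rewrite expRD ler_pM2l ?expR_gt0.
Qed.

End Visual.

Theorem theorem5p5 (R : realType) (X Y : metricType R)
    (properX : proper_space X) (geodX : geodesic_space X) (hypX : hyperbolic_space X)
    (properY : proper_space Y) (geodY : geodesic_space Y) (hypY : hyperbolic_space Y)
    (f : X -> Y) (radf : radial f) (a : X) (b : Y) :
  exists F : boundary a -> boundary b,
    induced_map f F /\
    forall (dX : boundary a -> boundary a -> R)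
           (dY : boundary b -> boundary b -> R),
      visual dX -> visual dY -> hoelder_map dX dY F.
Proof.
have [A [B [A0 fAB]]] := radial_gromov_ge a b geodX hypX hypY radf.
have [F fF] := induced_map_exists hypX hypY A0 fAB.
have [B' FAB] := induced_map_bgromov_ge hypY A0 fAB fF.
exists F; split=> // dX dY; exact: hoelder_of_bgromov_ge A0 FAB.
Qed.
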